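(* Up to isomorphism, every Boolean algebra is the clopen Boolean algebra of some Stone's space. More specifically, if $B$ is a Boolean algebra, then $B$ is isomorphic to the Boolean algebra $\mathrm{Clop}(\mathcal{U}(B))$.
   Context: A Boolean algebra $(B,+,\cdot,\neg)$ is written with join $+$, meet $\cdot$ and complement $\neg$, with bottom $0$ and top $1$; $x\leqslant y$ means $x+y=y$. A Stone's space is a compact Hausdorff totally disconnected topological space. For a topological space $X$, $\mathrm{Clop}(X)$ is the Boolean algebra of all clopen subsets of $X$ with $+=\cup$, $\cdot=\cap$, $\neg A=X\setminus A$ (the clopen Boolean algebra of $X$). A filter of $B$ is a nonempty subset $F\subset B$ closed under $\cdot$ and upward closed for $\leqslant$; it is proper if $F\neq B$. An ultrafilter of $B$ is a proper filter $F$ such that for every $x\in B$ exactly one of $x,\neg x$ lies in $F$. $\mathcal{U}(B)$ denotes the set of all ultrafilters of $B$, with the topology having as a basis the sets $U_x=\{F\in\mathcal{U}(B):x\in F\}$, $x\in B$. *)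

(* Defs.v *)
From HB Require Import structures.
From mathcomp Require Import all_boot all_order.
From mathcomp Require Import all_classical all_analysis.

Set Implicit Arguments.
Unset Strict Implicit.
Unset Printing Implicit Defensive.

Import Order.TTheory.
Local Open Scope classical_set_scope.

(* Boolean algebras are the ctbDistrLatticeType's of the order library, join,
   meet and complement being +, . and negation; lemma leEjoin says that x <= y
   is x `|` y == y. The degenerate algebra with \bot = \top is included: its
   space of ultrafilters is empty. *)

Definition boolean_isomorphism d d' (A : ctbDistrLatticeType d)
    (B : ctbDistrLatticeType d') (f : A -> B) : Prop :=
  [/\ bijective f,
      {morph f : x y / (x `|` y)%O},
      {morph f : x y / (x `&` y)%O} &
      {morph f : x / (~` x)%O}].

Definition boolean_isomorphic d d' (A : ctbDistrLatticeType d)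
    (B : ctbDistrLatticeType d') : Prop :=
  exists f : A -> B, boolean_isomorphism f.

Definition stone_space (X : topologicalType) : Prop :=
  [/\ compact [set: X], hausdorff_space X & totally_disconnected [set: X]].

Section Clop.
Variable X : topologicalType.

Record Clop := MkClop { clop_set :> set X; clop_clopen : clopen clop_set }.

Lemma clop_inj : injective clop_set.
Proof.
move=> [A cA] [B cB] /= AB; rewrite -{}AB in cB *.
by congr MkClop; exact: Prop_irrelevance.
Qed.

HB.instance Definition _ := gen_eqMixin Clop.
HB.instance Definition _ := gen_choiceMixin Clop.

Definition clopI (A B : Clop) : Clop :=
  MkClop (clopenI (clop_clopen A) (clop_clopen B)).
Definition clopU (A B : Clop) : Clop :=
  MkClop (clopenU (clop_clopen A) (clop_clopen B)).
Definition clopC (A : Clop) : Clop :=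
  MkClop (clopenC (clop_set A) (clop_clopen A)).
Definition clop0 : Clop := MkClop clopen0.
Definition clopT : Clop := MkClop clopenT.

Let le (A B : Clop) := `[< clop_set A `<=` clop_set B >].
Let lt (A B : Clop) := (B != A) && le A B.

Let le_def A B : le A B = (clopI A B == A).
Proof.
apply/asboolP/eqP => [/setIidPl AB|/(congr1 clop_set) /= /setIidPl //].
exact: clop_inj.
Qed.

Let lt_def A B : lt A B = (B != A) && le A B. Proof. by []. Qed.
Let clopIC : commutative clopI.
Proof. by move=> A B; apply: clop_inj; exact: setIC. Qed.
Let clopUC : commutative clopU.
Proof. by move=> A B; apply: clop_inj; exact: setUC. Qed.
Let clopIA : associative clopI.
Proof. by move=> A B C; apply: clop_inj; exact: setIA. Qed.
Let clopUA : associative clopU.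
Proof. by move=> A B C; apply: clop_inj; exact: setUA. Qed.
Let clopKU B A : clopI A (clopU A B) = A.
Proof. by apply: clop_inj; rewrite /= setUC setKU. Qed.
Let clopKI B A : clopU A (clopI A B) = A.
Proof. by apply: clop_inj; rewrite /= setIC setKI. Qed.
Let clopIUl : left_distributive clopI clopU.
Proof. by move=> A B C; apply: clop_inj; exact: setIUl. Qed.
Let clopII : idempotent_op clopI.
Proof. by move=> A; apply: clop_inj; exact: setIid. Qed.

HB.instance Definition _ :=
  Order.isMeetJoinDistrLattice.Build set_display Clop
    le_def lt_def clopIC clopUC clopIA clopUA clopKU clopKI clopIUl clopII.

Let clop0_le (A : Clop) : (clop0 <= A)%O.
Proof. by apply/asboolP; exact: sub0set. Qed.
Let clopT_ge (A : Clop) : (A <= clopT)%O.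
Proof. by apply/asboolP; exact: subsetT. Qed.

HB.instance Definition _ := Order.hasBottom.Build set_display Clop clop0_le.
HB.instance Definition _ := Order.hasTop.Build set_display Clop clopT_ge.

Let clopUCr (A : Clop) : (A `|` clopC A)%O = \top%O.
Proof. by apply: clop_inj; exact: setUv. Qed.
Let clopICr (A : Clop) : (A `&` clopC A)%O = \bot%O.
Proof. by apply: clop_inj; exact: setICr. Qed.

HB.instance Definition _ :=
  Order.TBDistrLattice_hasComplement.Build set_display Clop clopUCr clopICr.

Lemma clop_joinE (A B : Clop) : clop_set (A `|` B)%O = clop_set A `|` clop_set B.
Proof. by []. Qed.
Lemma clop_meetE (A B : Clop) : clop_set (A `&` B)%O = clop_set A `&` clop_set B.
Proof. by []. Qed.
Lemma clop_complE (A : Clop) : clop_set (~` A)%O = ~` clop_set A.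
Proof. by []. Qed.
Lemma clop_leE (A B : Clop) : (A <= B)%O = (clop_set A `<=` clop_set B) :> Prop.
Proof. by rewrite asboolE. Qed.

End Clop.

Section Ultrafilters.
Context {d : Order.disp_t} {B : ctbDistrLatticeType d}.

(* The library's Filter and UltraFilter are about filters of subsets of a type,
   not about filters of an abstract Boolean algebra. *)
Definition boolean_filter (F : set B) : Prop :=
  [/\ F !=set0,
      (forall x y, F x -> F y -> F (x `&` y)%O) &
      (forall x y, F x -> (x <= y)%O -> F y)].

Definition proper_boolean_filter (F : set B) : Prop :=
  boolean_filter F /\ F <> [set: B].

Definition boolean_ultrafilter (F : set B) : Prop :=
  proper_boolean_filter F /\
  forall x, (F x /\ ~ F (~` x)%O) \/ (~ F x /\ F (~` x)%O).

End Ultrafilters.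

Section UltrafilterSpace.
Context {d : Order.disp_t}.
Variable B : ctbDistrLatticeType d.

Record ultrafilters := MkUltrafilter {
  ult_set :> set B;
  ult_ultrafilter : boolean_ultrafilter ult_set }.

HB.instance Definition _ := gen_eqMixin ultrafilters.
HB.instance Definition _ := gen_choiceMixin ultrafilters.

Definition ult_basic (x : B) : set ultrafilters := [set F | ult_set F x].

Definition ult_basis : set (set ultrafilters) := range ult_basic.

Let ult_basis_cover : \bigcup_(U in ult_basis) U = [set: ultrafilters].
Proof.
rewrite -subTset => F _.
have [[[[x Fx] _ _] _] _] := ult_ultrafilter F.
by exists (ult_basic x) => //; exists x.
Qed.

Let ult_basis_join (U V : set ultrafilters) (F : ultrafilters) :
  ult_basis U -> ult_basis V -> U F -> V F ->
  exists W, [/\ ult_basis W, W F & W `<=` U `&` V].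
Proof.
move=> [x _ <-] [y _ <-] Fx Fy; exists (ult_basic (x `&` y)%O); split.
- by exists (x `&` y)%O.
- by have [[[_ FI _] _] _] := ult_ultrafilter F; exact: FI.
- move=> G Gxy; have [[[_ _ Gup] _] _] := ult_ultrafilter G.
  by split; apply: Gup Gxy _; [exact: leIl|exact: leIr].
Qed.

HB.instance Definition _ :=
  isBaseTopological.Build ultrafilters ult_basis_cover ult_basis_join.

Lemma ult_openE (A : set ultrafilters) :
  open A <-> exists2 D, D `<=` ult_basis & \bigcup_(U in D) U = A.
Proof. by []. Qed.

End UltrafilterSpace.

(* Main.v *)
Require Import Defs.
From mathcomp Require Import all_boot all_order.
From mathcomp Require Import all_classical all_analysis.

(** The isomorphism sends [a] to the set [ult_basic a] of the ultrafilters
    that contain [a]. Membership in an ultrafilter commutes with meets, joins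
    and complements, so this is a morphism into the clopen sets, and only its
    bijectivity and the topology of the ultrafilter space need an argument.

    Everything except compactness rests on the extension of proper filters to
    ultrafilters ([proper_filter_sub_ultrafilter]) or on the fact that two
    ultrafilters are separated by some [a]. The latter gives that the space is
    Hausdorff and totally disconnected, the basic sets being clopen.

    Compactness is read off set-theoretic ultrafilters on the space: such a [G]
    determines the Boolean ultrafilter of those [a] with [ult_basic a] in [G],
    and [G] converges to it ([ultrafilters_compact]).

    Injectivity ([ult_basic_le]): when [a <= b] fails, the element
    [a `&` ~` b] is not bottom, and an ultrafilter extending the principal
    filter above it contains [a] but not [b].

    Surjectivity ([clopen_ult_basic]): the elements [w] for which the trace of
    a clopen set [A] on [ult_basic w] is basic form an ideal, which meets every
    ultrafilter because [A] and its complement are open. An ideal meeting every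
    ultrafilter contains top, since otherwise the dual filter would extend to
    an ultrafilter; hence [A] itself is basic. *)

Set Implicit Arguments.
Unset Strict Implicit.
Unset Printing Implicit Defensive.

Import Order.Theory.
Local Open Scope classical_set_scope.

(** * Filters of a Boolean algebra *)

Section Filters.
Context {d : Order.disp_t} {B : ctbDistrLatticeType d}.
Implicit Types (a b x y z : B) (F A : set B).

Lemma boolean_filter_top F : boolean_filter F -> F \top%O.
Proof. by move=> [[x Fx] _ Fup]; apply: Fup Fx _; exact: lex1. Qed.

Lemma proper_boolean_filterP F :
  proper_boolean_filter F <-> boolean_filter F /\ ~ F \bot%O.
Proof.
split=> [[fF F_neqT]|[fF F0]]; split=> //; last by move=> FT; apply: F0; rewrite FT.
have [_ _ Fup] := fF => F0; apply: F_neqT; rewrite -subTset => x _.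
by apply: Fup F0 _; exact: le0x.
Qed.

Lemma principal_boolean_filter a : boolean_filter [set x | (a <= x)%O].
Proof.
split=> [|x y /= ax ay|x y /=]; [by exists a => /=| |exact: le_trans].
by rewrite lexI ax.
Qed.

(** When [F] is a filter, this is the filter generated by [F] and [x]. *)
Definition filter_adjoin F x : set B :=
  [set z | exists2 y, F y & (y `&` x <= z)%O].

Lemma filter_adjoin_filter F x :
  boolean_filter F -> boolean_filter (filter_adjoin F x).
Proof.
move=> [[y0 Fy0] FI _]; split.
- by exists y0, y0 => //; exact: leIl.
- move=> z w [y Fy yz] [y' Fy' yw]; exists (y `&` y')%O; first exact: FI.
  by rewrite lexI (le_trans _ yz) ?(le_trans _ yw) ?leI2 ?leIl ?leIr.
- by move=> z w [y Fy yz] zw; exists y => //; exact: le_trans zw.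
Qed.

Lemma sub_filter_adjoin F x : F `<=` filter_adjoin F x.
Proof. by move=> y Fy; exists y => //; exact: leIl. Qed.

Lemma filter_adjoin_mem F x : boolean_filter F -> filter_adjoin F x x.
Proof. by move=> /boolean_filter_top FT; exists \top%O => //; exact: leIr. Qed.

(** If [x] is not in a maximal proper filter then adjoining it produces bottom,
    that is, the filter has an element below [~` x]. *)
Lemma maximal_filter_ultrafilter F : proper_boolean_filter F ->
  (forall G, proper_boolean_filter G -> F `<=` G -> G `<=` F) ->
  boolean_ultrafilter F.
Proof.
move=> pF Fmax; split=> // x.
have /proper_boolean_filterP[fF F0] := pF; have [_ FI Fup] := fF.
have [Fx|nFx] := pselect (F x).
  by left; split=> // FCx; apply: F0; rewrite -(meetxC x); exact: FI.
right; split=> //; apply: contrapT => nFCx; apply: nFx.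
apply: (Fmax (filter_adjoin F x)); last exact: filter_adjoin_mem.
  apply/proper_boolean_filterP; split; first exact: filter_adjoin_filter.
  by move=> [y Fy]; rewrite lex0 disj_leC => /(Fup _ _ Fy).
exact: sub_filter_adjoin.
Qed.

(** Zorn's lemma, applied to the sets [A] whose union with [F] is a proper
    filter. Taking the union with [F] makes the empty chain harmless: its union
    is the empty set, which stands for [F] itself. *)
Lemma proper_filter_sub_ultrafilter F : proper_boolean_filter F ->
  exists U : ultrafilters B, F `<=` ult_set U.
Proof.
move=> pF; have /proper_boolean_filterP[fF F0] := pF.
pose P A := proper_boolean_filter (F `|` A).
have chainP (C : set (set B)) : C `<=` P -> total_on C subset ->
    P (\bigcup_(X in C) X).
  move=> CP Ctot; apply/proper_boolean_filterP; split; last first.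
    move=> [//|[X CX X0]]; have /proper_boolean_filterP[_] := CP X CX.
    by apply; right.
  have up X x : C X -> (F `|` X) x -> (F `|` \bigcup_(X in C) X) x.
    by move=> CX [Fx|Xx]; [left|right; exists X].
  have [_ FI Fup] := fF; split.
  - by exists \top%O; left; exact: boolean_filter_top.
  - have meetX X x y : C X -> (F `|` X) x -> (F `|` X) y ->
        (F `|` \bigcup_(X in C) X) (x `&` y)%O.
      by move=> CX Xx Xy; apply: (up X) => //; have [[_ XI _] _] := CP X CX; exact: XI.
    move=> x y [Fx|[X CX Xx]] [Fy|[Y CY Yy]].
    + by left; exact: FI.
    + by apply: (meetX Y) => //; [left|right].
    + by apply: (meetX X) => //; [right|left].
    + have [XY|YX] := Ctot X Y CX CY.
        by apply: (meetX Y) => //; right => //; exact: XY.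
      by apply: (meetX X) => //; right => //; exact: YX.
  - move=> x y [Fx|[X CX Xx]] xy; first by left; exact: Fup xy.
    apply: (up X) => //; have [[_ _ Xup] _] := CP X CX.
    by apply: Xup xy; right.
have [A [PA Amax]] := Zorn_bigcup chainP.
have uA : boolean_ultrafilter (F `|` A).
  apply: maximal_filter_ultrafilter => // G pG FAG x Gx.
  apply: contrapT => nFAx; apply: (Amax G).
    split=> [y Ay|]; first by apply: FAG; right.
    by move=> /(_ x Gx) Ax; apply: nFAx; right.
  rewrite /P (_ : F `|` G = G) //; apply/setUidPr.
  by apply: subset_trans FAG; exact: subsetUl.
by exists (MkUltrafilter uA); exact: subsetUl.
Qed.

End Filters.

(** * The basic clopen sets *)

Section Basic.
Context {d : Order.disp_t} {B : ctbDistrLatticeType d}.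
Implicit Types (a b x y z w : B) (U V : ultrafilters B).

Lemma ult_up U x y : ult_set U x -> (x <= y)%O -> ult_set U y.
Proof. by have [[[_ _ Uup] _] _] := ult_ultrafilter U; exact: Uup. Qed.

Lemma ult_meet U x y :
  ult_set U (x `&` y)%O <-> ult_set U x /\ ult_set U y.
Proof.
have [[[_ UI _] _] _] := ult_ultrafilter U; split=> [Uxy|[]]; last exact: UI.
by split; apply: ult_up Uxy _; [exact: leIl|exact: leIr].
Qed.

Lemma ult_compl U x : ult_set U (~` x)%O <-> ~ ult_set U x.
Proof.
by have [_ /(_ x)] := ult_ultrafilter U; tauto.
Qed.

Lemma ult_bot U : ~ ult_set U \bot%O.
Proof. by have [/proper_boolean_filterP[_ ?] _] := ult_ultrafilter U. Qed.

Lemma ult_basicI a b : ult_basic (a `&` b)%O = ult_basic a `&` ult_basic b.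
Proof. by apply/seteqP; split=> U /ult_meet. Qed.

Lemma ult_basicC a : ult_basic (~` a)%O = ~` ult_basic a.
Proof. by apply/seteqP; split=> U /ult_compl. Qed.

Lemma ult_basicU a b : ult_basic (a `|` b)%O = ult_basic a `|` ult_basic b.
Proof.
by rewrite -[(a `|` b)%O]complK complU ult_basicC ult_basicI !ult_basicC setCI !setCK.
Qed.

Lemma ult_basic0 : ult_basic \bot%O = set0 :> set (ultrafilters B).
Proof. by rewrite -subset0 => U /ult_bot. Qed.

Lemma ult_basicT : ult_basic \top%O = setT :> set (ultrafilters B).
Proof. by rewrite -compl0 ult_basicC ult_basic0 setC0. Qed.

Lemma ult_basic_open a : open (ult_basic a).
Proof.
rewrite ult_openE; exists [set ult_basic a]; last by rewrite bigcup_set1.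
by move=> _ ->; exists a.
Qed.

Lemma ult_basic_clopen a : clopen (ult_basic a).
Proof.
split; first exact: ult_basic_open.
by rewrite -openC -ult_basicC; exact: ult_basic_open.
Qed.

Lemma open_ult_basic (A : set (ultrafilters B)) U : open A -> A U ->
  exists2 a, ult_basic a U & ult_basic a `<=` A.
Proof.
rewrite ult_openE => -[D Db <-] [W DW WU]; have [a _ aW] := Db W DW.
by exists a; rewrite aW // => V WV; exists W.
Qed.

(** An inclusion of ultrafilters is an equality, so distinct ultrafilters are
    separated by an element lying in the first only. *)
Lemma ult_separated U V : U != V -> exists2 a, ult_set U a & ~ ult_set V a.
Proof.
move=> UV; apply: contrapT => nsep; move/eqP: UV; apply.
have UsubV a : ult_set U a -> ult_set V a.
  by move=> Ua; apply: contrapT => nVa; apply: nsep; exists a.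
have UV : ult_set U = ult_set V.
  apply/seteqP; split=> // a Va; apply: contrapT => /ult_compl/UsubV.
  by move/ult_compl; apply.
case: U V UV {nsep UsubV} => [U uU] [V uV] /= UV; rewrite -{}UV in uV *.
by congr MkUltrafilter; exact: Prop_irrelevance.
Qed.

Lemma ult_basic_le a b : ult_basic a `<=` ult_basic b -> (a <= b)%O.
Proof.
move=> sab; apply: contrapT => nab.
have [|U Uab] := @proper_filter_sub_ultrafilter _ B [set x | (a `&` ~` b <= x)%O].
  apply/proper_boolean_filterP; split; first exact: principal_boolean_filter.
  by rewrite /= lex0 disj_leC complK.
have /ult_meet[Ua /ult_compl] : ult_set U (a `&` ~` b)%O by exact: Uab (lexx _).
by apply; exact: sab.
Qed.

Lemma ult_basic_inj : injective (@ult_basic _ B).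
Proof.
by move=> a b ab; apply: le_anti; rewrite !ult_basic_le // ab.
Qed.

(** The filter below is dual to the ideal of those [w] for which the trace of
    [A] on [ult_basic w] is basic. *)
Lemma clopen_ult_basic (A : set (ultrafilters B)) :
  clopen A -> exists a, ult_basic a = A.
Proof.
move=> [oA cA].
pose F := [set z : B | exists a, ult_basic a = A `&` ult_basic (~` z)%O].
have fF : boolean_filter F.
  split.
  - by exists \top%O, \bot%O; rewrite compl1 ult_basic0 setI0.
  - move=> z w [a az] [b bw]; exists (a `|` b)%O.
    by rewrite complI !ult_basicU setIUr az bw.
  - move=> z w [a az] zw; exists (a `&` ~` w)%O.
    rewrite ult_basicI az -setIA -ult_basicI.
    by congr (_ `&` ult_basic _); apply/meet_idPr; rewrite leC.
have [F0|nF0] := pselect (F \bot%O).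
  by have [a aA] := F0; exists a; rewrite aA compl0 ult_basicT setIT.
have [U FU] : exists U : ultrafilters B, F `<=` ult_set U.
  by apply/proper_filter_sub_ultrafilter/proper_boolean_filterP.
(* The ultrafilter [U] has a basic neighbourhood inside [A] or inside its
   complement, on which the trace of [A] is everything or empty. *)
have [w Uw Fw] : exists2 w, ult_set U w & F (~` w)%O.
  have [AU|nAU] := pselect (A U).
    have [w Uw wA] := open_ult_basic oA AU.
    by exists w => //; exists w; rewrite complK setIidr.
  have oCA : open (~` A) by rewrite openC.
  have [w Uw wA] := open_ult_basic oCA nAU.
  exists w => //; exists \bot%O; rewrite complK ult_basic0.
  by apply/esym; rewrite setIC; exact/disjoints_subset.
by have /ult_compl := FU _ Fw.
Qed.

End Basic.

(** * The space of ultrafilters *)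

Section Space.
Context {d : Order.disp_t} (B : ctbDistrLatticeType d).

Lemma ultrafilters_compact : compact [set: ultrafilters B].
Proof.
rewrite compact_ultra => G uG _.
pose P := [set a : B | G (ult_basic a)].
have uP : boolean_ultrafilter P.
  split; [apply/proper_boolean_filterP; split; [split|]|].
  - by exists \top%O; rewrite /P /= ult_basicT; exact: filterT.
  - by move=> x y Gx Gy; rewrite /P /= ult_basicI; exact: filterI.
  - move=> x y Gx xy; apply: filterS Gx => U Ux; exact: ult_up xy.
  - by rewrite /P /= ult_basic0; exact: filter_not_empty.
  - move=> x; rewrite /P /= ult_basicC.
    have disj : ~ (G (ult_basic x) /\ G (~` ult_basic x)).
      move=> [Gx GCx]; apply: (@filter_not_empty _ G).
      by rewrite -(setICr (ult_basic x)); exact: filterI.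
    by have [Gx|GCx] := in_ultra_setVsetC (ult_basic x) uG; tauto.
exists (MkUltrafilter uP); split=> // A; rewrite nbhsE => -[N [oN NP] NA].
have [a Pa aN] := open_ult_basic oN NP.
by apply: filterS Pa => U /aN /NA.
Qed.

Lemma ultrafilters_hausdorff : hausdorff_space (ultrafilters B).
Proof.
rewrite open_hausdorff => U V /ult_separated[a Ua nVa].
exists (ult_basic a, ult_basic (~` a)%O) => /=.
  by rewrite !inE; split=> //; apply/ult_compl.
split; [exact: ult_basic_open|exact: ult_basic_open|].
by rewrite -ult_basicI meetxC ult_basic0.
Qed.

Lemma ultrafilters_totally_disconnected :
  totally_disconnected [set: ultrafilters B].
Proof.
apply: zero_dimension_totally_disconnected => U V /ult_separated[a Ua nVa].
by exists (ult_basic a); split=> //; exact: ult_basic_clopen.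
Qed.

Lemma ultrafilters_stone : stone_space (ultrafilters B).
Proof.
split; [exact: ultrafilters_compact|exact: ultrafilters_hausdorff|].
exact: ultrafilters_totally_disconnected.
Qed.

Lemma clop_ultrafilters_isomorphic :
  boolean_isomorphic B (Clop (ultrafilters B)).
Proof.
exists (fun a => MkClop (ult_basic_clopen a)); split.
- rewrite -setTT_bijective; split=> //.
    by move=> a b _ _ /(congr1 (@clop_set _))/ult_basic_inj.
  move=> A _; have [a aA] := clopen_ult_basic (clop_clopen A).
  by exists a => //; exact: clop_inj.
- by move=> a b; apply: clop_inj; exact: ult_basicU.
- by move=> a b; apply: clop_inj; exact: ult_basicI.
- by move=> a; apply: clop_inj; exact: ult_basicC.
Qed.

End Space.

Theorem theorem4p1 (d : Order.disp_t) (B : ctbDistrLatticeType d) :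
  (exists X : topologicalType,
     stone_space X /\ boolean_isomorphic B (Clop X)) /\
  (stone_space (ultrafilters B) /\
   boolean_isomorphic B (Clop (ultrafilters B))).
Proof.
have stoneB : stone_space (ultrafilters B) /\
    boolean_isomorphic B (Clop (ultrafilters B)).
  by split; [exact: ultrafilters_stone|exact: clop_ultrafilters_isomorphic].
by split=> //; exists (ultrafilters B).
Qed.
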